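(* Let $R$ be a principal ideal domain, let $A_*,B_*,C_*,D_*$ be chain complexes of $R$-modules with $A_**_RB_*$ and $C_**_RD_*$ acyclic, and let $e_*\colon A_*\to C_*$ and $f_*\colon B_*\to D_*$ be chain maps. Then for every elementary tor $\langle a,r,b\rangle\in H_i(A_* )*_RH_j(B_* )$, $$(e_*\otimes f_* )_*\bigl(\langle\!\langle a,r,b\rangle\!\rangle\bigr)\subset\langle\!\langle e_*(a),r,f_*(b)\rangle\!\rangle .$$ In words: the cosets $\langle\!\langle a,r,b\rangle\!\rangle$ are natural and do not depend on the weak splittings of the complexes.
   Context: Chain complexes are indexed by $\mathbb{Z}$, differential of degree $-1$; $\partial(x\otimes y)=\partial x\otimes y+(-1)^{|x|}x\otimes\partial y$; $[x]\times[y]=[x\otimes y]$. $\mathbf Z_n(C_* )$ denotes the cycles. $M*_RN=\mathrm{Tor}_1^R(M,N)$; $A_**_RB_*$ is the complex with degree-$n$ part $\bigoplus_{i+j=n}A_i*_RB_j$, defined like the tensor product complex. For a free resolution $0\to K\to F\to M\to0$, $M*_RN=\ker(K\otimes_RN\to F\otimes_RN)$; for $ar=0$, $rb=0$ the elementary tor $\langle a,r,b\rangle$ is $(\tilde a r)\otimes b$ with $\tilde a\in F$ a lift of $a$. Weak splitting: a weak splitting $\mathfrak g^A_*$ of $A_*$ consists, for each $n$, of a free resolution $0\to\mathcal B^A_n\subset\mathcal Z^A_n\xrightarrow{\hat\gamma^A_n}H_n(A_* )\to0$ and $R$-module maps $\gamma^A_n\colon\mathcal Z^A_n\to\mathbf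 Z_n(A_* )$, $\theta^A_n\colon\mathcal B^A_n\to A_{n+1}$ with $[\gamma^A_n(z)]=\hat\gamma^A_n(z)$ on $\mathcal Z^A_n$ and $\partial^A\theta^A_n=\gamma^A_n$ on $\mathcal B^A_n$. Every complex over a PID has a weak splitting. Given weak splittings of $A_*$, $B_*$, $\mu^{\mathfrak g^A_*,\mathfrak g^B_*}_{i,j}\colon H_i(A_* )*_RH_j(B_* )\to H_{i+j+1}(A_*\otimes_RB_* )$ is the (well-defined) $R$-module map with $\mu(\langle a,r,b\rangle)=[(-1)^{i+1}\gamma^A_i(\hat a)\otimes\theta^B_j(r\hat b)+\theta^A_i(\hat ar)\otimes\gamma^B_j(\hat b)]$ for any $\hat a\in\mathcal Z^A_i$, $\hat b\in\mathcal Z^B_j$ with $\hat\gamma^A_i(\hat a)=a$, $\hat\gamma^B_j(\hat b)=b$. Coset: $\langle\!\langle a,r,b\rangle\!\rangle\subset H_{i+j+1}(A_*\otimes_RB_* )$ denotes the coset of the subgroup $(a\times H_{j+1}(B_* ))\oplus(H_{i+1}(A_* )\times b)$ containing $\mu^{\mathfrak g^A_*,\mathfrak g^B_*}_{i,j}(\langle a,r,b\rangle)$, for any weak splittings $\mathfrak g^A_*,\mathfrak g^B_*$; part of the assertion is that this coset is the same for all choices. The coset for $C_*,D_*$ is defined in the same way. *)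

(* Defs.v *)
(* Homology of tensor products of Z-indexed chain complexes of modules over a
   principal ideal domain R, in the MathComp hierarchy ('lmodType R').  As R is
   commutative, the scalar r acts on the left: "a r = 0" reads 'r *: a = 0'. *)
From HB Require Import structures.
From mathcomp Require Import all_boot all_order all_algebra.
From mathcomp Require Import generic_quotient ring_quotient.
From mathcomp Require Import boolp classical_sets.

Set Implicit Arguments.
Unset Strict Implicit.
Unset Printing Implicit Defensive.

Import GRing.Theory.
Local Open Scope ring_scope.

(* Locked, so that simplification does not expose the underlying functions;
   unfold with linE. *)
HB.lock Definition lin (R : pzRingType) (U V : lmodType R) (f : U -> V)
  (Hf : linear f) : {linear U -> V} :=
  HB.pack f (GRing.isLinear.Build R U V *:%R f Hf).

Section LinearMaps.
Variable R : pzRingType.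

Lemma linE (U V : lmodType R) (f : U -> V) (Hf : linear f) x : lin Hf x = f x.
Proof. by rewrite lin.unlock. Qed.

Lemma linear_idfun (U : lmodType R) : linear (fun x : U => x).
Proof. by []. Qed.
Definition lid (U : lmodType R) : {linear U -> U} := lin (@linear_idfun U).

Lemma linear_zero (U V : lmodType R) : linear (fun _ : U => 0 : V).
Proof. by move=> a x y; rewrite scaler0 addr0. Qed.
Definition lzero (U V : lmodType R) : {linear U -> V} := lin (@linear_zero U V).

End LinearMaps.

Section Kernel.
Variables (R : pzRingType) (U V : lmodType R) (f : {linear U -> V}).

Definition ker_pred : {pred U} := fun x => f x == 0.

Lemma ker_closed : subsemimod_closed ker_pred.
Proof.
split; first split; rewrite ?unfold_in /ker_pred ?linear0 //.
- by move=> x y; rewrite !unfold_in /ker_pred linearD => /eqP-> /eqP->; rewrite addr0.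
- by move=> a x; rewrite !unfold_in /ker_pred linearZ_LR => /eqP->; rewrite scaler0.
Qed.
HB.instance Definition _ := GRing.isSubmodClosed.Build R U ker_pred ker_closed.

Record ker_type := Ker { kerval : U; _ : kerval \in ker_pred }.
HB.instance Definition _ := [isSub for kerval].
HB.instance Definition _ := [Choice of ker_type by <:].
HB.instance Definition _ := [SubChoice_isSubLmodule of ker_type by <:].

Definition kermod : lmodType R := ker_type.
End Kernel.

Section Submodules.
Variable R : pzRingType.

(* Prop-valued submodules: the library's 'submodClosed' is boolean. *)
Record submod (V : lmodType R) := Submod {
  smem :> V -> Prop;
  smem_closed : [/\ smem 0, forall x y, smem x -> smem y -> smem (x + y) &
    forall a x, smem x -> smem (a *: x)] }.

Lemma im_closed (U V : lmodType R) (f : {linear U -> V}) :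
  let P := fun y => exists x, f x = y in
  [/\ P 0, forall x y, P x -> P y -> P (x + y) & forall a x, P x -> P (a *: x)].
Proof.
split; first by exists 0; rewrite linear0.
- by move=> _ _ [x <-] [y <-]; exists (x + y); rewrite linearD.
- by move=> a _ [x <-]; exists (a *: x); rewrite linearZ_LR.
Qed.
Definition immod (U V : lmodType R) (f : {linear U -> V}) : submod V :=
  Submod (im_closed f).

Lemma span_closed (V : lmodType R) (G : V -> Prop) :
  let P := fun x => forall S : submod V, (forall y, G y -> S y) -> S x in
  [/\ P 0, forall x y, P x -> P y -> P (x + y) & forall a x, P x -> P (a *: x)].
Proof.
split.
- by move=> S _; case: (smem_closed S).
- by move=> x y Px Py S GS; case: (smem_closed S) => _ SD _; apply: SD; auto.
- by move=> a x Px S GS; case: (smem_closed S) => _ _ SZ; apply: SZ; auto.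
Qed.
Definition spanmod (V : lmodType R) (G : V -> Prop) : submod V :=
  Submod (span_closed G).
End Submodules.

Section Quotient.
Variables (R : pzRingType) (V : lmodType R) (S : submod V).

Definition sub_pred : {pred V} := fun x => `[< S x >].

Lemma sub_pred_closed : subsemimod_closed sub_pred.
Proof.
case: (smem_closed S) => S0 SD SZ; split; first split; rewrite ?unfold_in.
- exact/asboolP.
- by move=> x y /asboolP Sx /asboolP Sy; apply/asboolP/SD.
- by move=> a x /asboolP Sx; apply/asboolP/SZ.
Qed.
HB.instance Definition _ := GRing.isSubmodClosed.Build R V sub_pred sub_pred_closed.

Definition quot_type := Quotient.quot (sub_pred : zmodClosed V).
HB.instance Definition _ := GRing.Zmodule.on quot_type.

Definition qpi (x : V) : quot_type := (\pi_quot_type x)%qT.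

Lemma qpiP x y : (qpi x = qpi y) <-> S (x - y).
Proof.
have := Quotient.idealrBE (sub_pred : zmodClosed V) x y.
rewrite /in_mem /= /sub_pred => e; split.
- move=> exy; apply/asboolP; rewrite e; exact/eqP.
- by move/asboolP; rewrite e => /eqP.
Qed.

Lemma qpiD x y : qpi (x + y) = qpi x + qpi y.
Proof. by rewrite /qpi !piE. Qed.

Lemma qpiK (q : quot_type) : qpi (repr q) = q.
Proof. exact: reprK. Qed.

Definition qscale (a : R) (q : quot_type) : quot_type := qpi (a *: repr q).

Lemma qpi_scale a x : qpi (a *: x) = qscale a (qpi x).
Proof.
apply/qpiP; rewrite -scalerBr; case: (smem_closed S) => _ _; apply.
by apply/qpiP; rewrite qpiK.
Qed.

Lemma qscaleA a b q : qscale a (qscale b q) = qscale (a * b) q.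
Proof. by rewrite -[q]qpiK -!qpi_scale scalerA. Qed.
Lemma qscale1 : left_id 1 qscale.
Proof. by move=> q; rewrite -[q]qpiK -!qpi_scale scale1r. Qed.
Lemma qscaleDr : right_distributive qscale +%R.
Proof. by move=> a q r; rewrite -[q]qpiK -[r]qpiK -!qpi_scale -!qpiD -qpi_scale scalerDr. Qed.
Lemma qscaleDl q : {morph qscale^~ q : a b / a + b}.
Proof. by move=> a b; rewrite -[q]qpiK -!qpi_scale -qpiD scalerDl. Qed.

HB.instance Definition _ :=
  GRing.Zmodule_isLmodule.Build R quot_type qscaleA qscale1 qscaleDr qscaleDl.

Definition quotmod : lmodType R := quot_type.

Lemma qpi_linear : linear (qpi : V -> quotmod).
Proof. by move=> a x y; rewrite qpiD qpi_scale. Qed.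
Definition qproj : {linear V -> quotmod} := lin qpi_linear.

Definition qrepr (q : quotmod) : V := repr (q : quot_type).

Lemma qreprK q : qproj (qrepr q) = q.
Proof. by rewrite linE qpiK. Qed.

Lemma qproj_eq x y : qproj x = qproj y <-> S (x - y).
Proof. by rewrite !linE; exact: qpiP. Qed.

Lemma qproj_eq0 x : qproj x = 0 <-> S x.
Proof. by rewrite -(linear0 qproj) qproj_eq subr0. Qed.

Section Lift.
Variables (W : lmodType R) (f : {linear V -> W}).
Hypothesis fS : forall x, S x -> f x = 0.

Definition qlift_fun (q : quotmod) : W := f (qrepr q).
Lemma qlift_funE x : qlift_fun (qproj x) = f x.
Proof.
apply/eqP; rewrite -subr_eq0 /qlift_fun -linearB; apply/eqP/fS.
by apply/qproj_eq; rewrite qreprK.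
Qed.
Lemma qlift_linear : linear qlift_fun.
Proof.
by move=> a p q; rewrite -[p]qreprK -[q]qreprK -linearP !qlift_funE linearP.
Qed.
Definition qlift : {linear quotmod -> W} := lin qlift_linear.
Lemma qliftE x : qlift (qproj x) = f x.
Proof. by rewrite linE qlift_funE. Qed.
End Lift.
End Quotient.

Section DirectSum.
Variables (R : pzRingType) (I : choiceType) (X : I -> lmodType R).

(* The library's products 'T -> M' are non-dependent; dsum below is the direct
   sum of an arbitrary family of modules, as the finitely supported elements of
   its product. *)
Definition dprod_type := forall i, X i.
HB.instance Definition _ := Choice.on dprod_type.

Definition dprod_add (f g : dprod_type) : dprod_type := fun i => f i + g i.
Definition dprod_zero : dprod_type := fun i => 0.
Definition dprod_opp (f : dprod_type) : dprod_type := fun i => - f i.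
Definition dprod_scale a (f : dprod_type) : dprod_type := fun i => a *: f i.
Lemma dprod_addA : associative dprod_add.
Proof. by move=> f g h; apply: functional_extensionality_dep => i; exact: addrA. Qed.
Lemma dprod_addC : commutative dprod_add.
Proof. by move=> f g; apply: functional_extensionality_dep => i; exact: addrC. Qed.
Lemma dprod_add0 : left_id dprod_zero dprod_add.
Proof. by move=> f; apply: functional_extensionality_dep => i; exact: add0r. Qed.
Lemma dprod_addN : left_inverse dprod_zero dprod_opp dprod_add.
Proof. by move=> f; apply: functional_extensionality_dep => i; exact: addNr. Qed.
HB.instance Definition _ := GRing.isZmodule.Build dprod_type dprod_addA dprod_addC dprod_add0 dprod_addN.
Lemma dprod_scaleA a b f : dprod_scale a (dprod_scale b f) = dprod_scale (a * b) f.
Proof. by apply: functional_extensionality_dep => i; exact: scalerA. Qed.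
Lemma dprod_scale1 : left_id 1 dprod_scale.
Proof. by move=> f; apply: functional_extensionality_dep => i; exact: scale1r. Qed.
Lemma dprod_scaleDr : right_distributive dprod_scale +%R.
Proof. by move=> a f g; apply: functional_extensionality_dep => i; exact: scalerDr. Qed.
Lemma dprod_scaleDl f : {morph dprod_scale^~ f : a b / a + b}.
Proof. by move=> a b; apply: functional_extensionality_dep => i; exact: scalerDl. Qed.
HB.instance Definition _ :=
  GRing.Zmodule_isLmodule.Build R dprod_type dprod_scaleA dprod_scale1 dprod_scaleDr dprod_scaleDl.

Definition fin_supp : {pred dprod_type} :=
  fun f => `[< exists s : seq I, forall i, i \notin s -> f i = 0 >].

Lemma fin_supp_closed : subsemimod_closed fin_supp.
Proof.
split; first split; rewrite ?unfold_in.
- by apply/asboolP; exists [::].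
- move=> f g /asboolP[s Hs] /asboolP[t Ht]; apply/asboolP; exists (s ++ t) => i.
  rewrite mem_cat negb_or => /andP[/Hs fi /Ht gi].
  by rewrite -[LHS]/(f i + g i) fi gi addr0.
- move=> a f /asboolP[s Hs]; apply/asboolP; exists s => i /Hs fi.
  by rewrite -[LHS]/(a *: f i) fi scaler0.
Qed.
HB.instance Definition _ :=
  GRing.isSubmodClosed.Build R dprod_type fin_supp fin_supp_closed.

Record dsum_type := DSum { dfun : dprod_type; _ : dfun \in fin_supp }.
HB.instance Definition _ := [isSub for dfun].
HB.instance Definition _ := [Choice of dsum_type by <:].
HB.instance Definition _ := [SubChoice_isSubLmodule of dsum_type by <:].

Definition dsum : lmodType R := dsum_type.
Implicit Types (f g : dsum).

Definition coordf f i : X i := dfun f i.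

Lemma dcoord_linear i : linear (fun f => coordf f i).
Proof. by []. Qed.
Definition dcoord i : {linear dsum -> X i} := lin (@dcoord_linear i).

Lemma dsumP f g : (forall i, dcoord i f = dcoord i g) -> f = g.
Proof.
move=> H; apply: val_inj; apply: functional_extensionality_dep => i.
by have := H i; rewrite !linE.
Qed.

Lemma dsupp f : exists s : seq I, forall i, i \notin s -> dcoord i f = 0.
Proof.
case: f => f Hf; have /asboolP[s Hs] := Hf.
by exists s => i /Hs; rewrite linE.
Qed.

(* ecast transports x along the proof e : i = j. *)
Definition inj_fun i (x : X i) : dprod_type := fun j =>
  if @eqP _ i j is ReflectT e then ecast k (X k) e x else 0.

Lemma inj_supp i (x : X i) : inj_fun x \in fin_supp.
Proof.
apply/asboolP; exists [:: i] => j; rewrite inE /inj_fun.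
by case: eqP => // e; case: _ / e; rewrite eqxx.
Qed.

Lemma dinj_linear i : linear (fun x : X i => DSum (inj_supp x) : dsum).
Proof.
move=> a x y; apply: dsumP => j.
rewrite linearP !linE /coordf /= /inj_fun.
by case: eqP => [e|_]; [case: _ / e | rewrite scaler0 addr0].
Qed.
Definition dinj i : {linear X i -> dsum} := lin (@dinj_linear i).

Lemma dcoord_inj i (x : X i) : dcoord i (dinj i x) = x.
Proof.
rewrite !linE /coordf /= /inj_fun; case: eqP => // e.
by rewrite eq_axiomK.
Qed.
Lemma dcoord_inj_neq i j (x : X i) : i != j -> dcoord j (dinj i x) = 0.
Proof. by rewrite !linE /coordf /= /inj_fun; case: eqP. Qed.

Lemma dsum_decomp f (s : seq I) : uniq s ->
  (forall i, i \notin s -> dcoord i f = 0) ->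
  f = \sum_(i <- s) dinj i (dcoord i f).
Proof.
move=> us Hs; apply: dsumP => j; rewrite linear_sum.
case: (boolP (j \in s)) => js; last first.
  rewrite Hs // big1_seq // => i /andP[_ si]; rewrite dcoord_inj_neq //.
  by apply: contraNneq js => <-.
rewrite (bigD1_seq j) // dcoord_inj big1 ?[RHS]addr0 // => i ij.
by rewrite dcoord_inj_neq.
Qed.

Lemma dsum_ind (P : dsum -> Prop) : P 0 ->
  (forall f g, P f -> P g -> P (f + g)) ->
  (forall i (x : X i), P (dinj i x)) -> forall f, P f.
Proof.
move=> P0 PD Pi f; have [s Hs] := dsupp f.
rewrite (@dsum_decomp f (undup s)) ?undup_uniq //.
  by elim/big_ind: _ => //; auto.
by move=> i; rewrite mem_undup; exact: Hs.
Qed.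

Lemma dsum_ext (W : lmodType R) (u v : {linear dsum -> W}) :
  (forall i (x : X i), u (dinj i x) = v (dinj i x)) -> u =1 v.
Proof.
by move=> H; elim/dsum_ind => [|f g Hf Hg|//]; rewrite ?linear0 // !linearD Hf Hg.
Qed.

Section Lift.
Variables (W : lmodType R) (u : forall i, {linear X i -> W}).

Definition dlift_supp f : seq I := undup (projT1 (cid (dsupp f))).
Definition dlift_fun f : W := \sum_(i <- dlift_supp f) u i (dcoord i f).
Lemma dlift_suppP f i : i \notin dlift_supp f -> dcoord i f = 0.
Proof. by rewrite mem_undup; exact: (projT2 (cid (dsupp f))). Qed.

Lemma dlift_funE f (s : seq I) : uniq s -> (forall i, i \notin s -> dcoord i f = 0) ->
  dlift_fun f = \sum_(i <- s) u i (dcoord i f).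
Proof.
move=> us Hs; rewrite /dlift_fun; set r := undup (s ++ dlift_supp f).
have E t : uniq t -> {subset t <= r} -> (forall i, i \notin t -> dcoord i f = 0) ->
    \sum_(i <- t) u i (dcoord i f) = \sum_(i <- r) u i (dcoord i f).
  move=> ut tr Ht; rewrite (bigID (mem t)) /= [RHS](bigID (mem t)) /=.
  rewrite [X in _ + X]big1_seq ?[X in _ = _ + X]big1_seq ?addr0.
  - rewrite -big_filter -[RHS]big_filter; apply: perm_big; apply: uniq_perm.
    + exact: filter_uniq.
    + by rewrite filter_uniq // undup_uniq.
    + move=> i; rewrite !mem_filter.
      by case: (boolP (i \in t)) => //= /tr ->.
  - by move=> i /andP[/Ht-> _]; rewrite linear0.
  - by move=> i /andP[/negP].
rewrite (E s us _ Hs) ?(E (dlift_supp f) (undup_uniq _) _ (@dlift_suppP f)) // => i ri.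
- by rewrite /r mem_undup mem_cat ri orbT.
- by rewrite /r mem_undup mem_cat ri.
Qed.

Lemma dlift_linear : linear dlift_fun.
Proof.
move=> a f g; set s := undup (dlift_supp f ++ dlift_supp g).
have us : uniq s by exact: undup_uniq.
have Hs i : i \notin s -> (dcoord i f = 0) * (dcoord i g = 0).
  by rewrite mem_undup mem_cat negb_or => /andP[/dlift_suppP ? /dlift_suppP ?].
rewrite !(@dlift_funE _ s) //.
- by rewrite scaler_sumr -big_split; apply: eq_bigr => i _ /=; rewrite !linearP.
- by move=> i /Hs[].
- by move=> i /Hs[].
- by move=> i /Hs[fi gi]; rewrite linearP fi gi scaler0 addr0.
Qed.
Definition dlift : {linear dsum -> W} := lin dlift_linear.

Lemma dliftE i x : dlift (dinj i x) = u i x.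
Proof.
rewrite linE (@dlift_funE _ [:: i]) ?big_seq1 ?dcoord_inj //.
by move=> j; rewrite inE => ji; rewrite dcoord_inj_neq // eq_sym.
Qed.
End Lift.
End DirectSum.


Arguments dinj {R I} X i.
Arguments dcoord {R I} X i.

Section KernelMaps.
Variables (R : pzRingType).
Implicit Types U V W : lmodType R.

Lemma lcomp_linear U V W (g : {linear V -> W}) (f : {linear U -> V}) :
  linear (fun x => g (f x)).
Proof. by move=> a x y; rewrite !linearP. Qed.
Definition lcomp U V W (g : {linear V -> W}) (f : {linear U -> V}) :
  {linear U -> W} := lin (lcomp_linear g f).
Lemma lcompE U V W (g : {linear V -> W}) (f : {linear U -> V}) x :
  lcomp g f x = g (f x).
Proof. exact: linE. Qed.
Lemma lidE U (x : U) : lid U x = x.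
Proof. exact: linE. Qed.
Lemma lzeroE U V (x : U) : lzero U V x = 0.
Proof. exact: linE. Qed.

Lemma kin_linear U V (f : {linear U -> V}) :
  linear (fun x : kermod f => kerval x).
Proof. by []. Qed.
Definition kin U V (f : {linear U -> V}) : {linear kermod f -> U} :=
  lin (kin_linear (f := f)).

Lemma kinK U V (f : {linear U -> V}) (x : kermod f) : f (kin f x) = 0.
Proof. by rewrite linE; case: x => x Hx; apply/eqP. Qed.

Lemma kin_inj U V (f : {linear U -> V}) : injective (kin f).
Proof. by move=> x y; rewrite !linE; exact: val_inj. Qed.

Lemma mkker_subproof U V (f : {linear U -> V}) x :
  f x = 0 -> x \in ker_pred f.
Proof. by move/eqP. Qed.
Definition mkker U V (f : {linear U -> V}) x (fx : f x = 0) : kermod f :=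
  Ker (mkker_subproof fx).

Lemma kin_mkker U V (f : {linear U -> V}) x (fx : f x = 0) :
  kin f (mkker fx) = x.
Proof. by rewrite linE. Qed.

Lemma kerlift_linear U V W (f : {linear U -> V}) (g : {linear W -> U})
  (fg : forall w, f (g w) = 0) : linear (fun w => mkker (fg w)).
Proof. 
by move=> a x y; apply: kin_inj; rewrite [RHS]linearP !kin_mkker linearP.
Qed.
Definition kerlift U V W (f : {linear U -> V}) (g : {linear W -> U})
  (fg : forall w, f (g w) = 0) : {linear W -> kermod f} :=
  lin (kerlift_linear fg).

Lemma kin_kerlift U V W (f : {linear U -> V}) (g : {linear W -> U}) fg w :
  kin f (@kerlift U V W f g fg w) = g w.
Proof. by rewrite [kerlift _ _]linE kin_mkker. Qed.
End KernelMaps.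

Section FreeModule.
Variable R : comNzRingType.

Definition freemod (X : choiceType) : lmodType R := dsum (fun _ : X => R^o).
Definition fbasis (X : choiceType) (x : X) : freemod X :=
  dinj (fun _ : X => R^o) x (1 : R^o).

Lemma scale_linear (W : lmodType R) (w : W) : linear (fun a : R^o => a *: w).
Proof. by move=> a x y; rewrite scalerDl scalerA. Qed.

Definition flift (X : choiceType) (W : lmodType R) (g : X -> W) :
  {linear freemod X -> W} := dlift (fun x => lin (scale_linear (g x))).

Lemma flift_basis (X : choiceType) (W : lmodType R) (g : X -> W) x :
  flift g (fbasis x) = g x.
Proof. by rewrite dliftE linE scale1r. Qed.

Lemma dinj_basis (X : choiceType) (x : X) (a : R^o) :
  dinj (fun _ : X => R^o) x a = a *: fbasis x.
Proof. by rewrite -linearZ_LR; congr (dinj _ x _); rewrite -[RHS]/(a * 1) mulr1. Qed.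

Lemma free_ext (X : choiceType) (W : lmodType R) (u v : {linear freemod X -> W}) :
  (forall x, u (fbasis x) = v (fbasis x)) -> u =1 v.
Proof.
by move=> H; apply: dsum_ext => x a; rewrite dinj_basis !linearZ_LR H.
Qed.

Definition is_free (M : lmodType R) : Prop :=
  exists (X : choiceType) (f : {linear freemod X -> M}), bijective f.
End FreeModule.

Section Tensor.
Variable R : comNzRingType.
Implicit Types M N W : lmodType R.

(* M (x) N is the free module on the set M * N modulo the bilinearity
   relations. *)
Inductive tensor_rel M N : freemod R (M * N)%type -> Prop :=
| tensor_rel_Dl m m' n : tensor_rel
    (fbasis R (m + m', n) - (fbasis R (m, n) + fbasis R (m', n)))
| tensor_rel_Dr m n n' : tensor_rel
    (fbasis R (m, n + n') - (fbasis R (m, n) + fbasis R (m, n')))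
| tensor_rel_Zl a m n : tensor_rel
    (fbasis R (a *: m, n) - a *: fbasis R (m, n))
| tensor_rel_Zr a m n : tensor_rel
    (fbasis R (m, a *: n) - a *: fbasis R (m, n)).

Definition tensor M N : lmodType R := quotmod (spanmod (@tensor_rel M N)).

Definition tens M N (m : M) (n : N) : tensor M N := qproj _ (fbasis R (m, n)).

Lemma tensor_relE M N x y : spanmod (@tensor_rel M N) (x - y) ->
  qproj (spanmod (@tensor_rel M N)) x = qproj _ y.
Proof. by move=> H; apply/qproj_eq. Qed.

Lemma sub_aux (V : zmodType) (p q s t : V) :
  p - (s + t) = p - (q + t) + (q - s).
Proof. by rewrite -addrA; congr (p + _); rewrite !opprD [RHS]addrC addrA [q - s]addrC addrK. Qed.

Lemma tens_linearl M N (n : N) : linear (fun m : M => tens m n).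
Proof.
move=> a x y; rewrite /tens -linearP; apply: tensor_relE => S HS.
have [_ SD SZ] := smem_closed S.
have -> : fbasis R (a *: x + y, n) - (a *: fbasis R (x, n) + fbasis R (y, n)) =
  (fbasis R (a *: x + y, n) - (fbasis R (a *: x, n) + fbasis R (y, n))) +
  (fbasis R (a *: x, n) - a *: fbasis R (x, n)).
  by exact: sub_aux.
by apply: SD; apply: HS; [exact: tensor_rel_Dl | exact: tensor_rel_Zl].
Qed.
Lemma tens_linearr M N (m : M) : linear (fun n : N => tens m n).
Proof.
move=> a x y; rewrite /tens -linearP; apply: tensor_relE => S HS.
have [_ SD SZ] := smem_closed S.
have -> : fbasis R (m, a *: x + y) - (a *: fbasis R (m, x) + fbasis R (m, y)) =
  (fbasis R (m, a *: x + y) - (fbasis R (m, a *: x) + fbasis R (m, y))) +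
  (fbasis R (m, a *: x) - a *: fbasis R (m, x)).
  by exact: sub_aux.
by apply: SD; apply: HS; [exact: tensor_rel_Dr | exact: tensor_rel_Zr].
Qed.
Definition tensl M N (n : N) : {linear M -> tensor M N} := lin (tens_linearl n).
Definition tensr M N (m : M) : {linear N -> tensor M N} := lin (tens_linearr m).

Lemma tensDl M N (x y : M) (n : N) : tens (x + y) n = tens x n + tens y n.
Proof. by have := linearD (tensl M n) x y; rewrite !linE. Qed.
Lemma tensDr M N (m : M) (x y : N) : tens m (x + y) = tens m x + tens m y.
Proof. by have := linearD (tensr N m) x y; rewrite !linE. Qed.
Lemma tensBl M N (x y : M) (n : N) : tens (x - y) n = tens x n - tens y n.
Proof. by have := linearB (tensl M n) x y; rewrite !linE. Qed.
Lemma tensBr M N (m : M) (x y : N) : tens m (x - y) = tens m x - tens m y.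
Proof. by have := linearB (tensr N m) x y; rewrite !linE. Qed.
Lemma tensZl M N a (m : M) (n : N) : tens (a *: m) n = a *: tens m n.
Proof. by have := linearZ_LR (tensl M n) a m; rewrite !linE. Qed.
Lemma tensZr M N a (m : M) (n : N) : tens m (a *: n) = a *: tens m n.
Proof. by have := linearZ_LR (tensr N m) a n; rewrite !linE. Qed.
Lemma tens0l M N (n : N) : tens (0 : M) n = 0.
Proof. by have := linear0 (tensl M n); rewrite !linE. Qed.
Lemma tens0r M N (m : M) : tens m (0 : N) = 0.
Proof. by have := linear0 (tensr N m); rewrite !linE. Qed.

Lemma tens_ext M N W (u v : {linear tensor M N -> W}) :
  (forall m n, u (tens m n) = v (tens m n)) -> u =1 v.
Proof.
move=> H t; rewrite -(qreprK t).
have := @free_ext _ _ _ (lcomp u (qproj _)) (lcomp v (qproj _)) _ (qrepr t).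
by rewrite !lcompE; apply => -[m n]; rewrite !lcompE; exact: H.
Qed.

Section Lift.
Variables (M N W : lmodType R) (b : M -> N -> W).
Hypotheses (bl : forall n, linear (b^~ n)) (br : forall m, linear (b m)).

Definition tlift_fun : {linear freemod R (M * N)%type -> W} := flift (fun p => b p.1 p.2).

Lemma tlift_rel x : spanmod (@tensor_rel M N) x -> tlift_fun x = 0.
Proof.
have gE p : tlift_fun (fbasis R p) = b p.1 p.2 by exact: flift_basis.
have bDl m m' n : b (m + m') n = b m n + b m' n.
  by have := bl n 1 m m'; rewrite !scale1r.
have bDr m n n' : b m (n + n') = b m n + b m n'.
  by have := br m 1 n n'; rewrite !scale1r.
have bZl a m n : b (a *: m) n = a *: b m n.
  have b0 : b 0 n = 0 by apply: (addrI (b 0 n)); rewrite -bDl !addr0.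
  by have := bl n a m 0; rewrite b0 !addr0.
have bZr a m n : b m (a *: n) = a *: b m n.
  have b0 : b m 0 = 0 by apply: (addrI (b m 0)); rewrite -bDr !addr0.
  by have := br m a n 0; rewrite b0 !addr0.
have closed : [/\ tlift_fun 0 = 0, forall x y, tlift_fun x = 0 -> tlift_fun y = 0 -> tlift_fun (x + y) = 0 &
    forall a x, tlift_fun x = 0 -> tlift_fun (a *: x) = 0].
  split=> [|y z gy gz|a y gy]; first exact: linear0.
    by rewrite linearD gy gz addr0.
  by rewrite linearZ_LR gy scaler0.
move=> /(_ (@Submod R _ (fun x => tlift_fun x = 0) closed)); apply => y Hy.
suff: tlift_fun y = 0 by []; case: y / Hy => [m m' n|m n n'|a m n|a m n].
- by rewrite linearB linearD !gE /= bDl subrr.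
- by rewrite linearB linearD !gE /= bDr subrr.
- by rewrite linearB linearZ_LR !gE /= bZl subrr.
- by rewrite linearB linearZ_LR !gE /= bZr subrr.
Qed.
Definition tlift : {linear tensor M N -> W} := qlift tlift_rel.

Lemma tliftE m n : tlift (tens m n) = b m n.
Proof. by rewrite qliftE flift_basis. Qed.
End Lift.

Section Map.
Variables (M M' N N' : lmodType R) (f : {linear M -> M'}) (g : {linear N -> N'}).

Lemma tmap_linearl n : linear (fun m => tens (f m) (g n)).
Proof. by move=> a x y; rewrite linearP tensDl tensZl. Qed.
Lemma tmap_linearr m : linear (fun n => tens (f m) (g n)).
Proof. by move=> a x y; rewrite linearP tensDr tensZr. Qed.

Definition tmap : {linear tensor M N -> tensor M' N'} := tlift tmap_linearl tmap_linearr.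

Lemma tmapE m n : tmap (tens m n) = tens (f m) (g n).
Proof. exact: tliftE. Qed.
End Map.

Lemma tmap_comp M M' M'' N N' N'' (f : {linear M -> M'}) (g : {linear N -> N'})
    (f' : {linear M' -> M''}) (g' : {linear N' -> N''})
    (f'' : {linear M -> M''}) (g'' : {linear N -> N''}) t :
  (forall m, f' (f m) = f'' m) -> (forall n, g' (g n) = g'' n) ->
  tmap f' g' (tmap f g t) = tmap f'' g'' t.
Proof.
move=> fE gE; rewrite -[LHS](lcompE (tmap f' g') (tmap f g)).
by apply: tens_ext => m n; rewrite lcompE !tmapE fE gE.
Qed.

Lemma tmap0l M M' N N' (f : {linear M -> M'}) (g : {linear N -> N'}) t :
  (forall m, f m = 0) -> tmap f g t = 0.
Proof.
move=> f0; rewrite -[RHS](lzeroE (tensor M' N') t).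
by apply: tens_ext => m n; rewrite lzeroE tmapE f0 tens0l.
Qed.

Lemma tmap0r M M' N N' (f : {linear M -> M'}) (g : {linear N -> N'}) t :
  (forall n, g n = 0) -> tmap f g t = 0.
Proof.
move=> g0; rewrite -[RHS](lzeroE (tensor M' N') t).
by apply: tens_ext => m n; rewrite lzeroE tmapE g0 tens0r.
Qed.
End Tensor.

Section Tor.
Variable R : comNzRingType.
Implicit Types M N W : lmodType R.

(* Tor M N = ker (K (x) N -> F (x) N) for the resolution 0 -> K -> F -> M -> 0
   in which F is free on the underlying set of M.  K is free when R is a
   principal ideal domain. *)
Definition tor_F M : lmodType R := freemod R M.
Definition tor_eps M : {linear tor_F M -> M} := flift id.
Definition tor_K M : lmodType R := kermod (tor_eps M).
Definition tor_map M N : {linear tensor (tor_K M) N -> tensor (tor_F M) N} :=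
  tmap (kin (tor_eps M)) (lid N).
Definition Tor M N : lmodType R := kermod (tor_map M N).

Section Map.
Variables (M M' N N' : lmodType R) (f : {linear M -> M'}) (g : {linear N -> N'}).

Definition tor_Fmap : {linear tor_F M -> tor_F M'} :=
  flift (fun m => fbasis R (f m)).

Lemma tor_epsF x : tor_eps M' (tor_Fmap x) = f (tor_eps M x).
Proof.
rewrite -[LHS](lcompE (tor_eps M') tor_Fmap).
rewrite -[RHS](lcompE f (tor_eps M)).
by apply: free_ext => m; rewrite !lcompE !flift_basis.
Qed.

Lemma tor_Kmap_subproof x : tor_eps M' (lcomp tor_Fmap (kin (tor_eps M)) x) = 0.
Proof. by rewrite lcompE tor_epsF kinK linear0. Qed.
Definition tor_Kmap : {linear tor_K M -> tor_K M'} := kerlift tor_Kmap_subproof.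

Lemma kin_Kmap x : kin (tor_eps M') (tor_Kmap x) = tor_Fmap (kin (tor_eps M) x).
Proof. by rewrite kin_kerlift lcompE. Qed.

Lemma Tormap_subproof x :
  tor_map M' N' (lcomp (tmap tor_Kmap g) (kin (tor_map M N)) x) = 0.
Proof.
rewrite lcompE (tmap_comp (f'' := lcomp tor_Fmap (kin (tor_eps M))) (g'' := g)).
- rewrite -(tmap_comp (f := kin (tor_eps M)) (g := lid N) (f' := tor_Fmap) (g' := g)).
  + by rewrite kinK linear0.
  + by move=> m; rewrite [RHS]lcompE.
  + by move=> n; rewrite lidE.
- by move=> m; rewrite kin_Kmap [RHS]lcompE.
- by move=> n; rewrite lidE.
Qed.
Definition Tormap : {linear Tor M N -> Tor M' N'} := kerlift Tormap_subproof.

Lemma kin_Tormap x :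
  kin (tor_map M' N') (Tormap x) = tmap tor_Kmap g (kin (tor_map M N) x).
Proof. by rewrite kin_kerlift lcompE. Qed.
End Map.

Lemma Tormap_comp M M' M'' N N' N'' (f : {linear M -> M'}) (g : {linear N -> N'})
    (f' : {linear M' -> M''}) (g' : {linear N' -> N''})
    (f'' : {linear M -> M''}) (g'' : {linear N -> N''}) t :
  (forall m, f' (f m) = f'' m) -> (forall n, g' (g n) = g'' n) ->
  Tormap f' g' (Tormap f g t) = Tormap f'' g'' t.
Proof.
move=> fE gE; apply: kin_inj; rewrite !kin_Tormap.
apply: tmap_comp => // k; apply: kin_inj; rewrite !kin_Kmap.
rewrite -[LHS](lcompE (tor_Fmap f') (tor_Fmap f)).
by apply: free_ext => m; rewrite lcompE !flift_basis fE.
Qed.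

Lemma Tormap0r M M' N N' (f : {linear M -> M'}) (g : {linear N -> N'}) t :
  (forall n, g n = 0) -> Tormap f g t = 0.
Proof. by move=> g0; apply: kin_inj; rewrite kin_Tormap tmap0r // linear0. Qed.

Lemma Tormap0l M M' N N' (f : {linear M -> M'}) (g : {linear N -> N'}) t :
  (forall m, f m = 0) -> Tormap f g t = 0.
Proof.
move=> f0; apply: kin_inj; rewrite kin_Tormap linear0.
have Ff x : tor_eps M' (tor_Fmap f x) = 0 by rewrite tor_epsF f0.
rewrite -(tmap_comp (f := kin (tor_eps M)) (g := lid N) (f' := kerlift Ff) (g' := g)).
- by rewrite kinK linear0.
- by move=> k; apply: kin_inj; rewrite kin_kerlift kin_Kmap.
- by move=> n; rewrite lidE.
Qed.

(* The elementary tor <a, r, b> = (x r) (x) b with x in F a lift of a; the basis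
   element at a is such a lift, and etor_lift shows that any other lift gives
   the same element. *)
Section Elementary.
Variables (M N : lmodType R) (a : M) (r : R) (b : N).
Hypotheses (ar : r *: a = 0) (rb : r *: b = 0).

Lemma etor_subproof1 : tor_eps M (r *: fbasis R a) = 0.
Proof. by rewrite linearZ_LR flift_basis. Qed.
Lemma etor_subproof2 : tor_map M N (tens (mkker etor_subproof1) b) = 0.
Proof. by rewrite tmapE kin_mkker lidE tensZl -tensZr rb tens0r. Qed.
Definition etor : Tor M N := mkker etor_subproof2.

Lemma etor_lift (x : tor_F M) (k : tor_K M) : tor_eps M x = a ->
  kin (tor_eps M) k = r *: x -> kin (tor_map M N) etor = tens k b.
Proof.
move=> xa kx; rewrite kin_mkker.
have ex : tor_eps M (x - fbasis R a) = 0 by rewrite linearB xa flift_basis subrr.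
have -> : k = mkker etor_subproof1 + r *: mkker ex.
  apply: kin_inj; rewrite linearD linearZ_LR !kin_mkker kx scalerBr.
  by rewrite addrC subrK.
by rewrite tensDl tensZl -tensZr rb tens0r addr0.
Qed.
End Elementary.
End Tor.

Section Exactness.
Variable R : comNzRingType.
Implicit Types M N P : lmodType R.

Lemma tens_ind M N (P : tensor M N -> Prop) : P 0 ->
  (forall t u, P t -> P u -> P (t + u)) -> (forall m n, P (tens m n)) ->
  forall t, P t.
Proof.
move=> P0 PD Pt t; rewrite -(qreprK t).
elim/dsum_ind: (qrepr t) => [|f g Pf Pg|[m n] a].
- by rewrite linear0.
- by rewrite linearD; exact: PD.
- rewrite dinj_basis linearZ_LR.
  by rewrite -[qproj _ _]/(tens m n) -tensZl.
Qed.

Lemma tmap_surj M M' N N' (f : {linear M -> M'}) (g : {linear N -> N'}) :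
  (forall y, exists x, f x = y) -> (forall y, exists x, g x = y) ->
  forall t, exists u, tmap f g u = t.
Proof.
move=> fs gs; elim/tens_ind => [|_ _ [t <-] [u <-]|m n].
- by exists 0; rewrite linear0.
- by exists (t + u); rewrite linearD.
- by have [x <-] := fs m; have [y <-] := gs n; exists (tens x y); rewrite tmapE.
Qed.

Section RightExact.
Variables (M N P : lmodType R) (g : {linear N -> P}).
Hypothesis gs : forall y, exists x, g x = y.

Definition rex_im := immod (tmap (lid M) (kin g)).
Definition rex_sec (p : P) : N := projT1 (cid (gs p)).
Lemma rex_secK p : g (rex_sec p) = p. Proof. exact: (projT2 (cid (gs p))). Qed.

Definition rex_fun (m : M) (p : P) : quotmod rex_im := qproj rex_im (tens m (rex_sec p)).

Lemma rex_funE m n : rex_fun m (g n) = qproj rex_im (tens m n).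
Proof.
apply/qproj_eq; rewrite -tensBr.
have Hk : g (rex_sec (g n) - n) = 0 by rewrite linearB rex_secK subrr.
by exists (tens m (mkker Hk)); rewrite tmapE lidE kin_mkker.
Qed.

Lemma rex_linearl p : linear (rex_fun^~ p).
Proof. by move=> a x y; rewrite /rex_fun tensDl tensZl linearP. Qed.
Lemma rex_linearr m : linear (rex_fun m).
Proof.
move=> a x y; rewrite -[x]rex_secK -[y]rex_secK -linearP !rex_funE.
by rewrite tensDr tensZr linearP.
Qed.

Lemma tens_right_exact (t : tensor M N) : tmap (lid M) g t = 0 ->
  exists u, tmap (lid M) (kin g) u = t.
Proof.
move=> t0; suff /qproj_eq0 : qproj rex_im t = 0 by [].
have <- : tlift rex_linearl rex_linearr (tmap (lid M) g t) = qproj rex_im t.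
  rewrite -[LHS](lcompE (tlift rex_linearl rex_linearr) (tmap (lid M) g)).
  by apply: tens_ext => m n; rewrite lcompE tmapE tliftE lidE rex_funE.
by rewrite t0 linear0.
Qed.
End RightExact.

Section Flat.
Variable X : choiceType.

Lemma flat_inj_linear N (n : N) (x : X) :
  linear (fun a : R^o => dinj (fun _ : X => N) x (a *: n)).
Proof. by move=> a u v; rewrite scalerDl -scalerA linearP. Qed.

Definition flat_fun N (f : freemod R X) (n : N) : dsum (fun _ : X => N) :=
  dlift (fun x => lin (flat_inj_linear n x)) f.

Lemma flat_fun_basis N x (n : N) : flat_fun (fbasis R x) n = dinj (fun _ : X => N) x n.
Proof. by rewrite /flat_fun dliftE linE scale1r. Qed.

Lemma flat_fun_coord N (f : freemod R X) (n : N) x :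
  dcoord (fun _ : X => N) x (flat_fun f n) = (dcoord (fun _ : X => R^o) x f : R) *: n.
Proof.
elim/dsum_ind: f => [|f g Hf Hg|y a].
- by rewrite /flat_fun !linear0 scale0r.
- by rewrite /flat_fun !linearD scalerDl -Hf -Hg.
- rewrite /flat_fun dliftE linE; case: (eqVneq y x) => [->|yx].
    by rewrite !dcoord_inj.
  by rewrite !dcoord_inj_neq // scale0r.
Qed.

Lemma flat_linearl N (n : N) : linear (fun f => flat_fun f n).
Proof. by move=> a f g; rewrite /flat_fun linearP. Qed.
Lemma flat_linearr N f : linear (fun n : N => flat_fun f n).
Proof.
move=> a m n; apply: dsumP => x; rewrite linearP !flat_fun_coord.
by rewrite scalerDr !scalerA mulrC.
Qed.

Definition flat_tau N : {linear tensor (freemod R X) N -> dsum (fun _ : X => N)} :=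
  tlift (@flat_linearl N) (@flat_linearr N).
Definition flat_sigma N : {linear dsum (fun _ : X => N) -> tensor (freemod R X) N} :=
  dlift (fun x => tensr N (fbasis R x)).

Lemma flat_sigmaK N t : flat_sigma N (flat_tau N t) = t.
Proof.
rewrite -[RHS]lidE -[LHS](lcompE (flat_sigma N) (flat_tau N)).
apply: tens_ext => f n; rewrite lcompE lidE tliftE.
pose u := lcomp (flat_sigma N) (lin (flat_linearl n)).
have -> : flat_sigma N (flat_fun f n) = u f by rewrite lcompE linE.
have -> : tens f n = tensl _ n f by rewrite linE.
apply: free_ext => x; rewrite lcompE (linE (flat_linearl n)) flat_fun_basis dliftE.
by rewrite (linE (tens_linearr (fbasis R x))) (linE (tens_linearl n)).
Qed.

Lemma free_flat N N' (f : {linear N -> N'}) t : injective f ->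
  tmap (lid (freemod R X)) f t = 0 -> t = 0.
Proof.
move=> fi t0; rewrite -[t]flat_sigmaK.
suff -> : flat_tau N t = 0 by rewrite linear0.
apply: dsumP => x; rewrite linear0; apply: fi; rewrite linear0.
have -> : f (dcoord (fun _ : X => N) x (flat_tau N t)) =
    dcoord (fun _ : X => N') x (flat_tau N' (tmap (lid _) f t)).
  rewrite -(lcompE (dcoord _ x) (flat_tau N)) -(lcompE f).
  rewrite -(lcompE (flat_tau N')) -(lcompE (dcoord _ x)).
  apply: tens_ext => g n; rewrite !lcompE tmapE lidE !tliftE !flat_fun_coord.
  by rewrite linearZ_LR.
by rewrite t0 !linear0.
Qed.
End Flat.
End Exactness.

Section Complexes.
Variable R : idomainType.

(* The differential of degree -1 is given for all pairs of degrees and vanishes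
   unless n = m + 1; this avoids transports between the modules in degrees n
   and n + 1 - 1. *)
Record complex := Complex {
  cob :> int -> lmodType R;
  cd : forall n m, {linear cob n -> cob m};
  cd_shape : forall n m, n != m + 1 -> forall x, cd n m x = 0;
  cdd : forall n m k x, cd m k (cd n m x) = 0 }.

Record cmap (A C : complex) := ChainMap {
  cfun :> forall n, {linear A n -> C n};
  cfunE : forall n m x, cfun m (cd A n m x) = cd C n m (cfun n x) }.

Section Homology.
Variable A : complex.

Definition cycles n : lmodType R := kermod (cd A n (n - 1)).

Lemma cyclesP n (z : cycles n) m : cd A n m (kin _ z) = 0.
Proof.
case: (eqVneq n (m + 1)) => [nm|nm]; last exact: cd_shape.
have -> : m = n - 1 by rewrite nm addrK.
exact: kinK.
Qed.

Lemma bnd_subproof n x : cd A n (n - 1) (cd A (n + 1) n x) = 0.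
Proof. exact: cdd. Qed.
Definition bnd n : {linear A (n + 1) -> cycles n} := kerlift (@bnd_subproof n).

Definition homology n : lmodType R := quotmod (immod (bnd n)).

Definition hclass n : {linear cycles n -> homology n} := qproj (immod (bnd n)).

Lemma hclass_eqP n (z z' : cycles n) : hclass n z = hclass n z' <->
  exists w, cd A (n + 1) n w = kin _ z - kin _ z'.
Proof.
rewrite qproj_eq; split=> -[w Hw]; exists w.
  by rewrite -linearB -Hw kin_kerlift.
by apply: kin_inj; rewrite linearB -Hw kin_kerlift.
Qed.

Lemma hclass_surj n (h : homology n) : exists z, hclass n z = h.
Proof. by exists (qrepr h); exact: qreprK. Qed.

Definition acyclic := forall n (h : homology n), h = 0.
End Homology.

Section HomologyMap.
Variables (A C : complex) (e : cmap A C).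

Lemma zmap_subproof n x :
  cd C n (n - 1) (lcomp (e n) (kin (cd A n (n - 1))) x) = 0.
Proof. by rewrite lcompE -cfunE kinK linear0. Qed.
Definition zmap n : {linear cycles A n -> cycles C n} :=
  kerlift (@zmap_subproof n).

Lemma kin_zmap n z : kin _ (zmap n z) = e n (kin _ z).
Proof. by rewrite kin_kerlift lcompE. Qed.

Lemma hmap_subproof n x :
  immod (bnd A n) x -> lcomp (hclass C n) (zmap n) x = 0.
Proof.
case=> y <-; rewrite lcompE -(linear0 (hclass C n)); apply/hclass_eqP.
by exists (e (n + 1) y); rewrite linear0 subr0 kin_zmap kin_kerlift cfunE.
Qed.
Definition hmap n : {linear homology A n -> homology C n} :=
  qlift (@hmap_subproof n).

Lemma hmapE n z : hmap n (hclass A n z) = hclass C n (zmap n z).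
Proof. by rewrite qliftE lcompE. Qed.
End HomologyMap.

(* Commuting squares; the sign is introduced by the total complex.  The maps
   bh i i' j and bv i j j' are only used for i = i' + 1 and j = j' + 1. *)
Record bicomplex := Bicomplex {
  bob :> int -> int -> lmodType R;
  bh : forall i i' j, {linear bob i j -> bob i' j};
  bv : forall i j j', {linear bob i j -> bob i j'};
  bhh : forall i i' i'' j x, bh i' i'' j (bh i i' j x) = 0;
  bvv : forall i j j' j'' x, bv i j' j'' (bv i j j' x) = 0;
  bhv : forall i i' j j' x, bh i i' j' (bv i j j' x) = bv i' j j' (bh i i' j x) }.

Section Total.

Definition tot_idx (n : int) := {p : int * int | p.1 + p.2 == n}.
Definition tot_fam (X : int -> int -> lmodType R) n (p : tot_idx n) :
  lmodType R := X (val p).1 (val p).2.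
Definition totmod (X : int -> int -> lmodType R) n : lmodType R :=
  dsum (@tot_fam X n).

(* The inclusion of the summand X i j in degree n, and 0 if i + j <> n. *)
Definition tinj (X : int -> int -> lmodType R) i j n :
    {linear X i j -> totmod X n} :=
  match @idP (i + j == n) with
  | ReflectT e => dinj (@tot_fam X n) (exist _ (i, j) e)
  | ReflectF _ => lzero (X i j) (totmod X n)
  end.

Lemma tinj_neq (X : int -> int -> lmodType R) i j n (x : X i j) :
  i + j != n -> tinj X i j n x = 0.
Proof.
by rewrite /tinj => ne; destruct (@idP (i + j == n)) as [e|_];
  [rewrite e in ne | rewrite lzeroE].
Qed.

Lemma tinj_dinj (X : int -> int -> lmodType R) n (p : tot_idx n) x :
  dinj (@tot_fam X n) p x = tinj X (val p).1 (val p).2 n x.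
Proof.
case: p x => -[i j] e /= x; rewrite /tinj.
destruct (@idP (i + j == n)) as [e'|ne]; last by case: (ne e).
by rewrite (bool_irrelevance e e').
Qed.

Lemma tot_ext (X : int -> int -> lmodType R) n (W : lmodType R)
    (u v : {linear totmod X n -> W}) :
  (forall i j x, i + j = n -> u (tinj X i j n x) = v (tinj X i j n x)) -> u =1 v.
Proof.
move=> H; apply: dsum_ext => p x; rewrite tinj_dinj; apply: H.
by case: (p) => -[i j] /= /eqP.
Qed.

Variable X : bicomplex.

Lemma tot_d_linear i j m : linear (fun x : X i j =>
  tinj X (i - 1) j m (bh X i (i - 1) j x) +
  (-1 : R) ^ i *: tinj X i (j - 1) m (bv X i j (j - 1) x)).
Proof.
move=> a x y; rewrite !linearP !scalerDr -!addrA; congr (_ + _).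
by rewrite addrCA !scalerA mulrC.
Qed.

(* On the summand X i j: d x = h x + (-1)^i v x. *)
Definition tot_d n m : {linear totmod X n -> totmod X m} :=
  dlift (fun p : tot_idx n => lin (@tot_d_linear (val p).1 (val p).2 m)).

Lemma tot_dE i j i' j' n m x : i = i' + 1 -> j = j' + 1 -> i + j = n ->
  tot_d n m (tinj X i j n x) =
  tinj X i' j m (bh X i i' j x) + (-1 : R) ^ i *: tinj X i j' m (bv X i j j' x).
Proof.
move=> ii jj ijn.
have -> : i' = i - 1 by rewrite ii addrK.
have -> : j' = j - 1 by rewrite jj addrK.
have e : i + j == n by exact/eqP.
rewrite -[tinj X i j n x](@tinj_dinj X n (exist _ (i, j) e)).
by rewrite dliftE linE.
Qed.

Lemma tot_d_shape n m : n != m + 1 -> forall x, tot_d n m x = 0.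
Proof.
move=> nm x; rewrite -(lzeroE (totmod X m) x); move: x; apply: tot_ext => i j x ijn.
rewrite lzeroE (@tot_dE i j (i - 1) (j - 1)) ?subrK // !tinj_neq ?scaler0 ?addr0 //.
- by apply: contraNneq nm => <-; rewrite -ijn addrA subrK.
- by apply: contraNneq nm => <-; rewrite -ijn addrAC subrK.
Qed.

Lemma sgnS i : (-1 : R) ^ (i + 1) = - (-1) ^ i.
Proof. by rewrite exprzDr ?unitrN1 // expr1z mulrN1. Qed.
Lemma sgnB i : (-1 : R) ^ (i - 1) = - (-1) ^ i.
Proof. by rewrite -{2}(subrK 1 i) sgnS opprK. Qed.
Lemma sgn_sq i : (-1 : R) ^ i * (-1) ^ i = 1.
Proof. by rewrite -exprMz_comm ?unitrN1 // mulrNN mulr1 exp1rz. Qed.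

Lemma tot_dd n m k x : tot_d m k (tot_d n m x) = 0.
Proof.
case: (eqVneq n (m + 1)) => [nm|nm]; last first.
  by rewrite (tot_d_shape nm) linear0.
rewrite -(lcompE (tot_d m k)) -(lzeroE (totmod X k) x); move: x.
apply: tot_ext => i j x ijn; rewrite lcompE lzeroE.
have hm : i - 1 + j = m by rewrite addrAC ijn nm addrK.
have vm : i + (j - 1) = m by rewrite addrA ijn nm addrK.
rewrite (@tot_dE i j (i - 1) (j - 1)) ?subrK // linearD linearZ_LR.
rewrite (@tot_dE (i - 1) j (i - 1 - 1) (j - 1)) ?subrK //.
rewrite (@tot_dE i (j - 1) (i - 1) (j - 1 - 1)) ?subrK //.
rewrite bhh bvv bhv !linear0 add0r addr0 sgnB scaleNr.
by rewrite addNr.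
Qed.

Definition total : complex := Complex tot_d_shape tot_dd.
End Total.

Section TotalMap.
Variables (X Y : bicomplex) (phi : forall i j, {linear X i j -> Y i j}).
Hypothesis phih : forall i i' j x, phi i' j (bh X i i' j x) = bh Y i i' j (phi i j x).
Hypothesis phiv : forall i j j' x, phi i j' (bv X i j j' x) = bv Y i j j' (phi i j x).

Definition totmap_fun n : {linear total X n -> total Y n} :=
  dlift (fun p : tot_idx n =>
    lcomp (dinj (@tot_fam Y n) p) (phi (val p).1 (val p).2)).

Lemma totmap_funE i j n x :
  totmap_fun n (tinj X i j n x) = tinj Y i j n (phi i j x).
Proof.
case: (eqVneq (i + j) n) => [/eqP e|ne]; last by rewrite !tinj_neq ?linear0.
rewrite -[tinj X i j n x](@tinj_dinj X n (exist _ (i, j) e)).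
by rewrite dliftE lcompE tinj_dinj.
Qed.

Lemma totmap_comm n m x :
  totmap_fun m (cd (total X) n m x) = cd (total Y) n m (totmap_fun n x).
Proof.
rewrite -(lcompE (totmap_fun m)) -(lcompE (cd (total Y) n m)); move: x.
apply: tot_ext => i j x ijn; rewrite !lcompE totmap_funE.
rewrite !(@tot_dE _ i j (i - 1) (j - 1)) ?subrK // linearD linearZ_LR.
by rewrite !totmap_funE phih phiv.
Qed.

Definition totmap : cmap (total X) (total Y) := ChainMap totmap_comm.
End TotalMap.

Section TensorComplex.
Variables A B : complex.

Lemma tens_hh i i' i'' j x :
  tmap (cd A i' i'') (lid (B j)) (tmap (cd A i i') (lid (B j)) x) = 0.
Proof.
rewrite (tmap_comp (f'' := lzero _ _) (g'' := lid _)).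
- by apply: tmap0l => m; exact: lzeroE.
- by move=> m; rewrite cdd lzeroE.
- by move=> n; rewrite !lidE.
Qed.
Lemma tens_vv i j j' j'' x :
  tmap (lid (A i)) (cd B j' j'') (tmap (lid (A i)) (cd B j j') x) = 0.
Proof.
rewrite (tmap_comp (f'' := lid _) (g'' := lzero _ _)).
- by apply: tmap0r => m; exact: lzeroE.
- by move=> m; rewrite !lidE.
- by move=> n; rewrite cdd lzeroE.
Qed.
Lemma tens_hv i i' j j' x :
  tmap (cd A i i') (lid (B j')) (tmap (lid (A i)) (cd B j j') x) =
  tmap (lid (A i')) (cd B j j') (tmap (cd A i i') (lid (B j)) x).
Proof.
by rewrite !(tmap_comp (f'' := cd A i i') (g'' := cd B j j')) // => y; rewrite lidE.
Qed.

Definition tens_bicomplex : bicomplex := Bicomplex tens_hh tens_vv tens_hv.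
Definition tens_complex : complex := total tens_bicomplex.

Lemma tor_hh i i' i'' j x :
  Tormap (cd A i' i'') (lid (B j)) (Tormap (cd A i i') (lid (B j)) x) = 0.
Proof.
rewrite (Tormap_comp (f'' := lzero _ _) (g'' := lid _)).
- by apply: Tormap0l => m; exact: lzeroE.
- by move=> m; rewrite cdd lzeroE.
- by move=> n; rewrite !lidE.
Qed.
Lemma tor_vv i j j' j'' x :
  Tormap (lid (A i)) (cd B j' j'') (Tormap (lid (A i)) (cd B j j') x) = 0.
Proof.
rewrite (Tormap_comp (f'' := lid _) (g'' := lzero _ _)).
- by apply: Tormap0r => m; exact: lzeroE.
- by move=> m; rewrite !lidE.
- by move=> n; rewrite cdd lzeroE.
Qed.
Lemma tor_hv i i' j j' x :
  Tormap (cd A i i') (lid (B j')) (Tormap (lid (A i)) (cd B j j') x) =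
  Tormap (lid (A i')) (cd B j j') (Tormap (cd A i i') (lid (B j)) x).
Proof.
by rewrite !(Tormap_comp (f'' := cd A i i') (g'' := cd B j j')) // => y; rewrite lidE.
Qed.

Definition tor_bicomplex : bicomplex := Bicomplex tor_hh tor_vv tor_hv.
Definition tor_complex : complex := total tor_bicomplex.

(* x (x) y in degree n, for i + j = n. *)
Definition ctens i j n (x : A i) (y : B j) : tens_complex n :=
  tinj tens_bicomplex i j n (tens x y).

Lemma cd_ctens i j i' j' n m (x : A i) (y : B j) :
  i = i' + 1 -> j = j' + 1 -> i + j = n ->
  cd tens_complex n m (ctens n x y) =
  ctens m (cd A i i' x) y + (-1 : R) ^ i *: ctens m x (cd B j j' y).
Proof.
move=> ii jj ijn; rewrite /ctens (tot_dE (X := tens_bicomplex) _ _ ii jj ijn).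
by rewrite !tmapE !lidE.
Qed.

Lemma ctens_linearl i j n (y : B j) : linear (fun x : A i => ctens n x y).
Proof. by move=> a u v; rewrite /ctens tensDl tensZl linearP. Qed.
Lemma ctens_linearr i j n (x : A i) : linear (fun y : B j => ctens n x y).
Proof. by move=> a u v; rewrite /ctens tensDr tensZr linearP. Qed.

Lemma cross_subproof i j n (x : cycles A i) (y : cycles B j) :
  cd tens_complex n (n - 1) (ctens n (kin _ x) (kin _ y)) = 0.
Proof.
case: (eqVneq (i + j) n) => [ijn|ne]; last by rewrite /ctens tinj_neq ?linear0.
rewrite (@cd_ctens i j (i - 1) (j - 1)) ?subrK // !kinK /ctens.
by rewrite tens0l tens0r !linear0 addr0.
Qed.
Definition zcross i j n (x : cycles A i) (y : cycles B j) :
  cycles tens_complex n := mkker (cross_subproof n x y).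

(* [x] x [y] = [x (x) y] in degree n, for i + j = n; qrepr picks representing
   cycles, and cross_class shows that the choice is immaterial. *)
Definition cross i j n (a : homology A i) (b : homology B j) :
    homology tens_complex n :=
  hclass tens_complex n (zcross n (qrepr a) (qrepr b)).

Lemma cross_class i j n (x : cycles A i) (y : cycles B j) :
  cross n (hclass A i x) (hclass B j y) = hclass tens_complex n (zcross n x y).
Proof.
apply/hclass_eqP; rewrite !kin_mkker.
case: (eqVneq (i + j) n) => [ijn|ne]; last first.
  by exists 0; rewrite linear0 /ctens !tinj_neq // subr0.
set x' := qrepr _; set y' := qrepr _.
have /hclass_eqP[u Hu] : hclass A i x' = hclass A i x by exact: qreprK.
have /hclass_eqP[v Hv] : hclass B j y' = hclass B j y by exact: qreprK.
have n1 : i + 1 + j = n + 1 by rewrite addrAC ijn.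
have n2 : i + (j + 1) = n + 1 by rewrite addrA ijn.
exists (ctens (n + 1) u (kin _ y') + (-1 : R) ^ i *: ctens (n + 1) (kin _ x) v).
rewrite linearD linearZ_LR (@cd_ctens (i + 1) j i (j - 1)) ?subrK //.
rewrite (@cd_ctens i (j + 1) (i - 1) j) ?subrK // Hu Hv !kinK.
rewrite scalerDr scalerA sgn_sq scale1r.
have c0l p q (b : B q) : ctens n (0 : A p) b = 0 by rewrite /ctens tens0l linear0.
have c0r p q (a : A p) : ctens n a (0 : B q) = 0 by rewrite /ctens tens0r linear0.
rewrite c0l c0r !scaler0 addr0 add0r /ctens tensBl tensBr !linearB.
by rewrite addrA subrK.
Qed.

Lemma cross_linearl i j n (b : homology B j) :
  linear (fun a : homology A i => cross n a b).
Proof.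
move=> r a a'; have [x <-] := hclass_surj a; have [x' <-] := hclass_surj a'.
have [y <-] := hclass_surj b.
rewrite -linearP !cross_class -linearP; congr (hclass _ _ _); apply: kin_inj.
by rewrite [RHS]linearP !kin_mkker linearP (ctens_linearl n (kin _ y)).
Qed.
Lemma cross_linearr i j n (a : homology A i) :
  linear (fun b : homology B j => cross n a b).
Proof.
move=> r b b'; have [y <-] := hclass_surj b; have [y' <-] := hclass_surj b'.
have [x <-] := hclass_surj a.
rewrite -linearP !cross_class -linearP; congr (hclass _ _ _); apply: kin_inj.
by rewrite [RHS]linearP !kin_mkker linearP (ctens_linearr n (kin _ x)).
Qed.

Lemma cross_sub_closed i j (a : homology A i) (b : homology B j) :
  let P h := exists (y : homology B (j + 1)) (x : homology A (i + 1)),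
    h = cross (i + j + 1) a y + cross (i + j + 1) x b in
  [/\ P 0, forall x y, P x -> P y -> P (x + y) & forall c x, P x -> P (c *: x)].
Proof.
pose u := lin (@cross_linearr i (j + 1) (i + j + 1) a).
pose v := lin (@cross_linearl (i + 1) j (i + j + 1) b).
have uE y : cross (i + j + 1) a y = u y by rewrite linE.
have vE x : cross (i + j + 1) x b = v x by rewrite linE.
split.
- by exists 0, 0; rewrite uE vE !linear0 addr0.
- move=> _ _ [y [x ->]] [y' [x' ->]]; exists (y + y'), (x + x').
  by rewrite !uE !vE !linearD addrACA.
- move=> c _ [y [x ->]]; exists (c *: y), (c *: x).
  by rewrite !uE !vE !linearZ_LR scalerDr.
Qed.
End TensorComplex.

Section TensorMap.
Variables (A B C D : complex) (e : cmap A C) (f : cmap B D).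

Lemma tens_cmap_h i i' j x :
  tmap (e i') (f j) (bh (tens_bicomplex A B) i i' j x) =
  bh (tens_bicomplex C D) i i' j (tmap (e i) (f j) x).
Proof.
rewrite (tmap_comp (f'' := lcomp (e i') (cd A i i')) (g'' := f j)).
- rewrite (tmap_comp (f'' := lcomp (e i') (cd A i i')) (g'' := f j)) // => y.
    by rewrite lcompE cfunE.
  by rewrite lidE.
- by move=> y; rewrite lcompE.
- by move=> y; rewrite lidE.
Qed.
Lemma tens_cmap_v i j j' x :
  tmap (e i) (f j') (bv (tens_bicomplex A B) i j j' x) =
  bv (tens_bicomplex C D) i j j' (tmap (e i) (f j) x).
Proof.
rewrite (tmap_comp (f'' := e i) (g'' := lcomp (f j') (cd B j j'))).
- rewrite (tmap_comp (f'' := e i) (g'' := lcomp (f j') (cd B j j'))) // => y.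
    by rewrite lidE.
  by rewrite lcompE cfunE.
- by move=> y; rewrite lidE.
- by move=> y; rewrite lcompE.
Qed.
Definition tens_cmap : cmap (tens_complex A B) (tens_complex C D) :=
  @totmap (tens_bicomplex A B) (tens_bicomplex C D)
    (fun i j => tmap (e i) (f j)) tens_cmap_h tens_cmap_v.

Lemma tens_cmapE i j n (x : A i) (y : B j) :
  tens_cmap n (ctens n x y) = ctens n (e i x) (f j y).
Proof. by rewrite /ctens totmap_funE tmapE. Qed.
End TensorMap.
End Complexes.

Section WeakSplittings.
Variable R : idomainType.
Local Notation complex := (complex R).

Definition is_pid : Prop :=
  forall I : submod R^o, exists x : R, forall y : R, I y <-> exists c, y = c * x.

(* wshat, wsgamma, wstheta are the maps hat-gamma, gamma, theta; the free
   resolution 0 -> wsB n -> wsZ n -> H_n(A) -> 0 has wsB n = ker (wshat n). *)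
Record wsplit (A : complex) := WeakSplitting {
  wsZ : int -> lmodType R;
  wshat : forall n, {linear wsZ n -> homology A n};
  wshat_surj : forall n h, exists z, wshat n z = h;
  wsZ_free : forall n, is_free (wsZ n);
  wsB_free : forall n, is_free (kermod (wshat n));
  wsgamma : forall n, {linear wsZ n -> cycles A n};
  wstheta : forall n, {linear kermod (wshat n) -> A (n + 1)};
  wsgammaE : forall n z, hclass A n (wsgamma n z) = wshat n z;
  wsthetaE : forall n (z : kermod (wshat n)),
    cd A (n + 1) n (wstheta n z) = kin _ (wsgamma n (kin _ z)) }.

Definition wsB (A : complex) (g : wsplit A) n : lmodType R := kermod (wshat g n).

Lemma scale_aux1 (V : lmodType R) (a s : R) (x x' y y' : V) :
  a *: x + x' + s *: (a *: y + y') = a *: (x + s *: y) + (x' + s *: y').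
Proof. by rewrite !scalerDr !scalerA (mulrC s a) addrACA. Qed.

Lemma scale_aux2 (V : lmodType R) (r s : R) (p q u v : V) :
  s *: (p - q) + r *: v = s *: p + (u + r *: v) - (u + s *: q).
Proof.
rewrite scalerBr opprD [u + _]addrC -!addrA (addrA u) subrr add0r.
by congr (_ + _); rewrite addrC.
Qed.

Section Mu.
Variables (A B : complex) (gA : wsplit A) (gB : wsplit B) (i j : int).

(* ka and kb stand for za * r and r * zb viewed in wsB. *)
Definition mu_chain (za : wsZ gA i) (ka : wsB gA i) (zb : wsZ gB j)
    (kb : wsB gB j) : tens_complex A B (i + j + 1) :=
  (-1 : R) ^ (i + 1) *:
    ctens (i + j + 1) (kin _ (wsgamma gA i za)) (wstheta gB j kb) +
  ctens (i + j + 1) (wstheta gA i ka) (kin _ (wsgamma gB j zb)).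

Lemma mu_idx1 : i + (j + 1) = i + j + 1. Proof. exact: addrA. Qed.
Lemma mu_idx2 : i + 1 + j = i + j + 1. Proof. exact: addrAC. Qed.

Lemma mu_idx3 : i + 1 + (j + 1) = i + j + 1 + 1. Proof. by rewrite addrA (addrAC i 1 j). Qed.

Lemma ctens0l n p q (b : B q) : ctens n (0 : A p) b = 0.
Proof. by rewrite /ctens tens0l linear0. Qed.
Lemma ctens0r n p q (a : A p) : ctens n a (0 : B q) = 0.
Proof. by rewrite /ctens tens0r linear0. Qed.

Lemma cd_ctens_gamma_theta m (x : cycles A i) (kb : wsB gB j) :
  cd (tens_complex A B) (i + j + 1) m (ctens _ (kin _ x) (wstheta gB j kb)) =
  (-1 : R) ^ i *: ctens m (kin _ x) (kin _ (wsgamma gB j (kin _ kb))).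
Proof.
have idx := mu_idx1.
rewrite (@cd_ctens _ _ _ i (j + 1) (i - 1) j) ?subrK //.
by rewrite cyclesP ctens0l add0r wsthetaE.
Qed.
Lemma cd_ctens_theta_gamma m (ka : wsB gA i) (y : cycles B j) :
  cd (tens_complex A B) (i + j + 1) m (ctens _ (wstheta gA i ka) (kin _ y)) =
  ctens m (kin _ (wsgamma gA i (kin _ ka))) (kin _ y).
Proof.
have idx := mu_idx2.
rewrite (@cd_ctens _ _ _ (i + 1) j i (j - 1)) ?subrK //.
by rewrite cyclesP ctens0r scaler0 addr0 wsthetaE.
Qed.

Lemma mu_chain_subproof (r : R) za ka zb kb :
  kin _ ka = r *: za -> kin _ kb = r *: zb ->
  cd (tens_complex A B) (i + j + 1) (i + j + 1 - 1) (mu_chain za ka zb kb) = 0.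
Proof.
move=> kaE kbE; rewrite /mu_chain linearD linearZ_LR cd_ctens_gamma_theta cd_ctens_theta_gamma kaE kbE.
rewrite sgnS scaleNr scalerA sgn_sq scale1r /ctens !(linearZ_LR (wsgamma _ _)).
by rewrite !linearZ_LR tensZl tensZr addNr.
Qed.

Definition mu_cycle (r : R) za ka zb kb (kaE : kin _ ka = r *: za)
    (kbE : kin _ kb = r *: zb) : cycles (tens_complex A B) (i + j + 1) :=
  mkker (mu_chain_subproof kaE kbE).

Definition is_mu
    (m : {linear Tor (homology A i) (homology B j) ->
                 homology (tens_complex A B) (i + j + 1)}) : Prop :=
  forall (a : homology A i) (r : R) (b : homology B j)
    (ar : r *: a = 0) (rb : r *: b = 0)
    (za : wsZ gA i) (ka : wsB gA i) (zb : wsZ gB j) (kb : wsB gB j)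
    (kaE : kin _ ka = r *: za) (kbE : kin _ kb = r *: zb),
  wshat gA i za = a -> wshat gB j zb = b ->
  m (etor ar rb) = hclass _ _ (mu_cycle kaE kbE).

Section Existence.

Definition mu_lft (a : homology A i) : wsZ gA i := projT1 (cid (wshat_surj gA a)).
Definition mu_phi : {linear tor_F (homology A i) -> wsZ gA i} := flift mu_lft.
Lemma mu_phiE x : wshat gA i (mu_phi x) = tor_eps _ x.
Proof.
rewrite -(lcompE (wshat gA i) mu_phi); apply: free_ext => a.
rewrite lcompE !flift_basis; exact: (projT2 (cid (wshat_surj gA a))).
Qed.
Lemma mu_phiK_sub x : wshat gA i (lcomp mu_phi (kin (tor_eps (homology A i))) x) = 0.
Proof. by rewrite lcompE mu_phiE kinK. Qed.
Definition mu_phiK : {linear tor_K (homology A i) -> wsB gA i} := kerlift mu_phiK_sub.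

Definition mu_Psi1 : {linear tensor (tor_K (homology A i)) (wsZ gB j) ->
    tens_complex A B (i + j + 1)} :=
  lcomp (tinj (tens_bicomplex A B) (i + 1) j (i + j + 1))
    (tmap (lcomp (wstheta gA i) mu_phiK) (lcomp (kin _) (wsgamma gB j))).
Definition mu_Psi2 : {linear tensor (tor_F (homology A i)) (wsB gB j) ->
    tens_complex A B (i + j + 1)} :=
  lcomp (tinj (tens_bicomplex A B) i (j + 1) (i + j + 1))
    (tmap (lcomp (kin _) (lcomp (wsgamma gA i) mu_phi)) (wstheta gB j)).
Definition mu_Theta : {linear tensor (tor_K (homology A i)) (wsB gB j) ->
    tens_complex A B (i + j + 1 + 1)} :=
  lcomp (tinj (tens_bicomplex A B) (i + 1) (j + 1) (i + j + 1 + 1))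
    (tmap (lcomp (wstheta gA i) mu_phiK) (wstheta gB j)).

Lemma mu_Psi1E k z : mu_Psi1 (tens k z) =
  ctens _ (wstheta gA i (mu_phiK k)) (kin _ (wsgamma gB j z)).
Proof. by rewrite lcompE tmapE !lcompE. Qed.
Lemma mu_Psi2E x k : mu_Psi2 (tens x k) =
  ctens _ (kin _ (wsgamma gA i (mu_phi x))) (wstheta gB j k).
Proof. by rewrite lcompE tmapE !lcompE. Qed.
Lemma mu_ThetaE k l : mu_Theta (tens k l) =
  ctens _ (wstheta gA i (mu_phiK k)) (wstheta gB j l).
Proof. by rewrite lcompE tmapE !lcompE. Qed.

Definition mu_Psi zeta eta := mu_Psi1 zeta + (-1 : R) ^ (i + 1) *: mu_Psi2 eta.

Definition mu_KtoF N := tmap (kin (tor_eps (homology A i))) (lid N).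
Definition mu_BtoZ M := tmap (lid M) (kin (wshat gB j)).

Lemma mu_kin_phiK k : kin _ (mu_phiK k) = mu_phi (kin _ k).
Proof. by rewrite kin_kerlift lcompE. Qed.

Definition mu_Upsilon m : {linear tensor (tor_F (homology A i)) (wsZ gB j) ->
    tens_complex A B m} :=
  lcomp (tinj (tens_bicomplex A B) i j m)
    (tmap (lcomp (kin _) (lcomp (wsgamma gA i) mu_phi)) (lcomp (kin _) (wsgamma gB j))).

Lemma mu_UpsilonE m x z : mu_Upsilon m (tens x z) =
  ctens _ (kin _ (wsgamma gA i (mu_phi x))) (kin _ (wsgamma gB j z)).
Proof. by rewrite lcompE tmapE !lcompE. Qed.

Lemma mu_dPsi1 m z : cd (tens_complex A B) (i + j + 1) m (mu_Psi1 z) = mu_Upsilon m (mu_KtoF _ z).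
Proof.
elim/tens_ind: z => [|t u Ht Hu|k z].
- by rewrite !linear0.
- by rewrite !linearD Ht Hu.
- by rewrite mu_Psi1E cd_ctens_theta_gamma tmapE lidE mu_UpsilonE mu_kin_phiK.
Qed.
Lemma mu_dPsi2 m z : cd (tens_complex A B) (i + j + 1) m (mu_Psi2 z) =
  (-1 : R) ^ i *: mu_Upsilon m (mu_BtoZ _ z).
Proof.
elim/tens_ind: z => [|t u Ht Hu|x k].
- by rewrite !linear0.
- by rewrite !linearD Ht Hu.
- by rewrite mu_Psi2E cd_ctens_gamma_theta tmapE lidE mu_UpsilonE.
Qed.

Lemma mu_Psi_cycle zeta eta : mu_BtoZ _ eta = mu_KtoF _ zeta ->
  cd (tens_complex A B) (i + j + 1) (i + j + 1 - 1) (mu_Psi zeta eta) = 0.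
Proof.
move=> E; rewrite /mu_Psi linearD linearZ_LR mu_dPsi1 mu_dPsi2 E sgnS scaleNr scalerA.
by rewrite sgn_sq scale1r subrr.
Qed.

Definition mu_rel (xi : Tor (homology A i) (homology B j))
    (h : homology (tens_complex A B) (i + j + 1)) : Prop :=
  exists zeta eta (E : mu_BtoZ _ eta = mu_KtoF _ zeta),
    tmap (lid _) (wshat gB j) zeta = kin _ xi /\
    h = hclass _ _ (mkker (mu_Psi_cycle E)).

Lemma mu_rel_total xi : exists h, mu_rel xi h.
Proof.
have [zeta Hz] := @tmap_surj _ _ _ _ _ (lid _) (wshat gB j)
  (fun y => ex_intro _ y (lidE y)) (@wshat_surj _ gB j) (kin _ xi).
have [|eta E] := @tens_right_exact _ (tor_F (homology A i)) _ _ _ (@wshat_surj _ gB j)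
    (mu_KtoF _ zeta).
  rewrite (tmap_comp (f'' := kin (tor_eps (homology A i))) (g'' := wshat gB j)).
  - rewrite -(tmap_comp (f := lid _) (g := wshat gB j)
      (f' := kin (tor_eps (homology A i))) (g' := lid _)).
    + by rewrite Hz; exact: kinK.
    + by move=> m; rewrite lidE.
    + by move=> n; rewrite lidE.
  - by move=> m; rewrite lidE.
  - by move=> n; rewrite lidE.
by exists (hclass _ _ (mkker (mu_Psi_cycle E))), zeta, eta, E.
Qed.

Lemma mu_rel_lin a x y h k : mu_rel x h -> mu_rel y k -> mu_rel (a *: x + y) (a *: h + k).
Proof.
move=> [z [e [E [zx ->]]]] [z' [e' [E' [zy ->]]]].
have E'' : mu_BtoZ _ (a *: e + e') = mu_KtoF _ (a *: z + z') by rewrite !linearP E E'.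
exists (a *: z + z'), (a *: e + e'), E''; split; first by rewrite !linearP zx zy.
rewrite -linearP; congr (hclass _ _ _); apply: kin_inj.
rewrite linearP !kin_mkker /mu_Psi (linearP mu_Psi1) (linearP mu_Psi2).
by rewrite scale_aux1.
Qed.

Lemma mu_rel0 h : mu_rel 0 h -> h = 0.
Proof.
move=> [zeta [eta [E [z0 ->]]]]; rewrite linear0 in z0.
have [kappa Hk] := tens_right_exact (@wshat_surj _ gB j) z0.
have etaE : eta = tmap (kin (tor_eps _)) (lid _) kappa.
  apply/eqP; rewrite -subr_eq0; apply/eqP.
  apply: (@free_flat _ _ _ _ (kin (wshat gB j))); first exact: kin_inj.
  apply/eqP; rewrite linearB subr_eq0; apply/eqP; rewrite [LHS]E -Hk.
  by rewrite !(tmap_comp (f'' := kin (tor_eps _)) (g'' := kin (wshat gB j)))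
    // => ?; rewrite lidE.
rewrite -(linear0 (hclass _ _)); apply/hclass_eqP.
rewrite kin_mkker linear0 subr0 /mu_Psi etaE -Hk.
exists ((-1 : R) ^ (i + 1) *: mu_Theta kappa); rewrite linearZ_LR.
elim/tens_ind: (kappa) => [|t u Ht Hu|k l].
- by rewrite !linear0 addr0.
- rewrite (linearD mu_Theta) (linearD (cd _ _ _)) scalerDr Ht Hu.
  rewrite !(linearD (tmap _ _)) (linearD mu_Psi1) (linearD mu_Psi2) scalerDr.
  exact: addrACA.
- rewrite mu_ThetaE !tmapE !lidE mu_Psi1E mu_Psi2E.
  have idx := mu_idx3.
  rewrite (@cd_ctens _ _ _ (i + 1) (j + 1) i j) //.
  by rewrite !wsthetaE scalerDr scalerA sgn_sq scale1r mu_kin_phiK; exact: addrC.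
Qed.

Definition mu_mfun xi := projT1 (cid (mu_rel_total xi)).
Lemma mu_mfunP xi : mu_rel xi (mu_mfun xi). Proof. exact: (projT2 (cid (mu_rel_total xi))). Qed.
Lemma mu_rel_fun xi h k : mu_rel xi h -> mu_rel xi k -> h = k.
Proof.
move=> Hh Hk; apply/eqP; rewrite -subr_eq0; apply/eqP/mu_rel0.
have := mu_rel_lin (-1) Hk Hh; rewrite !scaleN1r addNr.
by rewrite [_ + h]addrC.
Qed.
Lemma mu_mlin : linear mu_mfun.
Proof. by move=> a x y; apply: (mu_rel_fun (mu_mfunP _)); apply: mu_rel_lin; exact: mu_mfunP. Qed.

Lemma mu_exists : exists m, is_mu m.
Proof.
exists (lin mu_mlin) => a r b ar rb za ka zb kb kaE kbE zaE zbE.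
rewrite linE; apply: (mu_rel_fun (mu_mfunP _)).
pose k0 : tor_K _ := mkker (etor_subproof1 ar).
have E : mu_BtoZ _ (tens (fbasis R a) kb) = mu_KtoF _ (tens k0 zb).
  by rewrite !tmapE !lidE kbE kin_mkker tensZl tensZr.
exists (tens k0 zb), (tens (fbasis R a) kb), E; split.
  by rewrite tmapE lidE zbE kin_mkker.
have Hd : wshat gA i (za - mu_phi (fbasis R a)) = 0.
  by rewrite linearB mu_phiE flift_basis zaE subrr.
pose dd : wsB gA i := mkker Hd.
have dE : kin _ dd = za - mu_phi (fbasis R a) by exact: kin_mkker.
have kE : ka = mu_phiK k0 + r *: dd.
  apply: kin_inj; rewrite linearD linearZ_LR kaE mu_kin_phiK kin_mkker dE scalerBr.
  by rewrite linearZ_LR addrC subrK.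
apply/hclass_eqP; rewrite !kin_mkker /mu_Psi /mu_chain mu_Psi1E mu_Psi2E kE.
exists ((-1 : R) ^ (i + 1) *: ctens _ (wstheta gA i dd) (wstheta gB j kb)).
rewrite linearZ_LR.
have idx := mu_idx3.
  rewrite (@cd_ctens _ _ _ (i + 1) (j + 1) i j) //.
rewrite !wsthetaE dE scalerDr scalerA sgn_sq scale1r kbE.
have -> : ctens (i + j + 1) (kin _ (wsgamma gA i (za - mu_phi (fbasis R a))))
    (wstheta gB j kb) = ctens _ (kin _ (wsgamma gA i za)) (wstheta gB j kb) -
    ctens _ (kin _ (wsgamma gA i (mu_phi (fbasis R a)))) (wstheta gB j kb).
  by rewrite /ctens !linearB tensBl linearB.
have -> : ctens (i + j + 1) (wstheta gA i dd) (kin _ (wsgamma gB j (r *: zb))) =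
    r *: ctens _ (wstheta gA i dd) (kin _ (wsgamma gB j zb)).
  by rewrite /ctens !linearZ_LR tensZr linearZ_LR.
have -> : ctens (i + j + 1) (wstheta gA i (mu_phiK k0 + r *: dd))
    (kin _ (wsgamma gB j zb)) =
    ctens _ (wstheta gA i (mu_phiK k0)) (kin _ (wsgamma gB j zb)) +
    r *: ctens _ (wstheta gA i dd) (kin _ (wsgamma gB j zb)).
  by rewrite /ctens linearD linearZ_LR tensDl tensZl linearD linearZ_LR.
exact: scale_aux2.
Qed.
End Existence.

(* Any two maps satisfying is_mu agree on elementary tors. *)
Definition mu : {linear Tor (homology A i) (homology B j) ->
    homology (tens_complex A B) (i + j + 1)} := projT1 (cid mu_exists).

Lemma muP : is_mu mu.
Proof. exact: (projT2 (cid mu_exists)). Qed.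

(* The subgroup a x H_{j+1}(B) + H_{i+1}(A) x b. *)
Definition cross_sub (a : homology A i) (b : homology B j) :
    submod (homology (tens_complex A B) (i + j + 1)) :=
  Submod (cross_sub_closed a b).

Definition tor_coset (a : homology A i) (r : R) (b : homology B j)
    (ar : r *: a = 0) (rb : r *: b = 0) :
    set (homology (tens_complex A B) (i + j + 1)) :=
  [set h | cross_sub a b (h - mu (etor ar rb))]%classic.
End Mu.

Lemma hmap_scale0 (A C : complex) (e : cmap A C) n r (a : homology A n) :
  r *: a = 0 -> r *: hmap e n a = 0.
Proof. by move=> ra; rewrite -linearZ_LR ra linear0. Qed.
End WeakSplittings.

(* Main.v *)
Require Import Defs.
From HB Require Import structures.
From mathcomp Require Import all_boot all_order all_algebra.
From mathcomp Require Import boolp classical_sets.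

(** The coset has a description that does not mention weak splittings.  Let x
    and y be cycles representing a and b, and let u and v be chains with
    du = r x and dv = r y.  Then (-1)^(i+1) x (x) v + u (x) y is a cycle, and the
    formula defining mu on an elementary tor exhibits mu <a, r, b> as the class
    of such a cycle ([mu_tor_class]): the weak splittings only provide one
    choice of x, y, u and v.

    Two choices give classes that differ by an element of
    a x H_(j+1)(B) + H_(i+1)(A) x b ([tor_class_unique]).  Indeed, changing x
    and y within their homology classes, and u and v accordingly, changes the
    cycle by a boundary; and for fixed x and y two choices of u, or of v, differ
    by a cycle, which contributes a cross product with b, or with a.

    Hence the coset consists of the classes congruent to one of these cycles
    ([tor_cosetE]), for all weak splittings.  Chain maps carry x, y, u and v to
    data of the same kind for the image classes ([hmap_tor_class]), and preserve
    cross products ([hmap_cross]), whence naturality. *)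

Import GRing.Theory.
Local Open Scope classical_set_scope.
Local Open Scope ring_scope.

Section TorClass.
Variable R : idomainType.

Set Implicit Arguments.
Unset Strict Implicit.

(** The Massey-type product of a, r and b: the classes of the cycles
    (-1)^(i+1) x (x) v + u (x) y as x, y, u and v vary. *)
Definition tor_class (A B : complex R) (i j : int) (a : homology A i) (r : R)
    (b : homology B j) (h : homology (tens_complex A B) (i + j + 1)) : Prop :=
  exists (x : cycles A i) (y : cycles B j) (u : A (i + 1)) (v : B (j + 1))
    (z : cycles (tens_complex A B) (i + j + 1)),
  [/\ hclass A i x = a /\ hclass B j y = b,
      cd A (i + 1) i u = r *: kin _ x, cd B (j + 1) j v = r *: kin _ y,
      kin _ z = (-1 : R) ^ (i + 1) *: ctens _ (kin _ x) v + ctens _ u (kin _ y)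
    & h = hclass _ _ z].

Section CtensArith.
Variables (A B : complex R) (p q n : int).

Lemma ctensDl (x x' : A p) (y : B q) :
  ctens n (x + x') y = ctens n x y + ctens n x' y.
Proof. by rewrite /ctens tensDl linearD. Qed.

Lemma ctensDr (x : A p) (y y' : B q) :
  ctens n x (y + y') = ctens n x y + ctens n x y'.
Proof. by rewrite /ctens tensDr linearD. Qed.

Lemma ctensZl c (x : A p) (y : B q) : ctens n (c *: x) y = c *: ctens n x y.
Proof. by rewrite /ctens tensZl linearZ_LR. Qed.

Lemma ctensZr c (x : A p) (y : B q) : ctens n x (c *: y) = c *: ctens n x y.
Proof. by rewrite /ctens tensZr linearZ_LR. Qed.

End CtensArith.

(** The bookkeeping of signs in [tor_class_unique]: the left side is the boundary
    of the correcting chain, and the right side the difference of the two cycles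
    minus the cross products by which their classes differ.  The terms d2 and d4,
    which carry the Koszul sign s twice, come out without a sign. *)
Lemma sign_collect (V : lmodType R) (s : R) (d1 d2 d3 d4 c1 c2 w1 w2 : V) :
  s * s = 1 ->
  s *: (d1 + s *: d2 + (d3 + s *: d4)) =
  s *: (w1 + c1 + d3 + d1) + (w2 + c2 + d4 + d2) - (s *: w1 + w2)
  - (s *: c1 + c2).
Proof.
move=> ss; apply/eqP; rewrite eq_sym !subr_eq !scalerDr !scalerA ss !scale1r.
by rewrite !addrA; apply/eqP; rewrite [RHS](ACl (7*5*3*1*8*6*4*2)).
Qed.

Section Coset.
Variables (A B : complex R) (i j : int).
Variables (a : homology A i) (r : R) (b : homology B j).

(** The difference of two classes is computed exactly: with x - x' = ds and
    y - y' = dt, it is the cross product of x' with the cycle v - r t - v', up to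
    sign, plus that of the cycle u - r s - u' with y'. *)
Lemma tor_class_unique h h' :
  tor_class a r b h -> tor_class a r b h' -> cross_sub a b (h - h').
Proof.
move=> [x [y [u [v [z [[xa yb] du dv zE ->]]]]]].
move=> [x' [y' [u' [v' [z' [[x'a y'b] du' dv' z'E ->]]]]]].
have /hclass_eqP[s ds] : hclass A i x = hclass A i x' by rewrite xa x'a.
have /hclass_eqP[t dt] : hclass B j y = hclass B j y' by rewrite yb y'b.
(* The chains u - r s and v - r t bound r x' and r y', as u' and v' do. *)
have p0 : cd A (i + 1) (i + 1 - 1) (u - r *: s - u') = 0.
  rewrite addrK !linearB linearZ_LR du du' ds scalerBr opprB.
  by rewrite [_ + (_ - _)]addrC subrK subrr.
have q0 : cd B (j + 1) (j + 1 - 1) (v - r *: t - v') = 0.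
  rewrite addrK !linearB linearZ_LR dv dv' dt scalerBr opprB.
  by rewrite [_ + (_ - _)]addrC subrK subrr.
set p := u - _ - _ in p0; set q := v - _ - _ in q0.
have uE : u = u' + p + r *: s by rewrite [u' + p]addrC !subrK.
have vE : v = v' + q + r *: t by rewrite [v' + q]addrC !subrK.
have xE : kin _ x = kin _ x' + cd A (i + 1) i s.
  by rewrite ds [RHS]addrC subrK.
have yE : kin _ y = kin _ y' + cd B (j + 1) j t.
  by rewrite dt [RHS]addrC subrK.
have xv : ctens (i + j + 1) (kin _ x) v =
    ctens _ (kin _ x') v' + ctens _ (kin _ x') q +
    r *: ctens _ (kin _ x') t + ctens _ (cd A (i + 1) i s) v.
  by rewrite xE ctensDl {1}vE !ctensDr ctensZr.
have uy : ctens (i + j + 1) u (kin _ y) =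
    ctens _ u' (kin _ y') + ctens _ p (kin _ y') +
    ctens _ (u' + p) (cd B (j + 1) j t) + r *: ctens _ s (kin _ y).
  by rewrite {1}uE ctensDl ctensZl; congr (_ + _); rewrite yE ctensDr -ctensDl.
exists (hclass B _ ((-1 : R) ^ (i + 1) *: mkker q0)), (hclass A _ (mkker p0)).
rewrite -x'a -y'b !cross_class -linearB -linearD; apply/hclass_eqP.
(* Up to the sign, subtracting the boundary of s (x) v from the cycle replaces
   x by x' and u by u - r s, which is u' + p; subtracting that of
   (u - r s) (x) t then replaces y by y' and v by v - r t. *)
exists ((-1 : R) ^ (i + 1) *: (ctens _ s v + ctens _ (u' + p) t)).
have idx := mu_idx3 i j.
rewrite linearZ_LR linearD !(@cd_ctens _ _ _ (i + 1) (j + 1) i j) //.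
have -> : cd A (i + 1) i (u' + p) = r *: kin _ x'.
  have -> : u' + p = u - r *: s by rewrite [u' + p]addrC subrK.
  by rewrite linearB linearZ_LR du ds scalerBr opprB addrC subrK.
rewrite (linearB (kin _)) (linearD (kin _)) !kin_mkker linearZ_LR kin_mkker zE z'E.
rewrite xv uy dv ctensZl !ctensZr.
by apply: sign_collect; exact: sgn_sq.
Qed.

(** Lifts za and zb of a and b give x = gamma(za), y = gamma(zb),
    u = theta(r za) and v = theta(r zb); the identity d theta = gamma gives
    the conditions on u and v. *)
Lemma mu_tor_class (gA : wsplit A) (gB : wsplit B)
    (ar : r *: a = 0) (rb : r *: b = 0) :
  tor_class a r b (mu gA gB i j (etor ar rb)).
Proof.
have [za zaE] := wshat_surj gA a; have [zb zbE] := wshat_surj gB b.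
have ka0 : wshat gA i (r *: za) = 0 by rewrite linearZ_LR zaE.
have kb0 : wshat gB j (r *: zb) = 0 by rewrite linearZ_LR zbE.
pose ka : wsB gA i := mkker ka0; pose kb : wsB gB j := mkker kb0.
have kaE : kin _ ka = r *: za by exact: kin_mkker.
have kbE : kin _ kb = r *: zb by exact: kin_mkker.
exists (wsgamma gA i za), (wsgamma gB j zb), (wstheta gA i ka),
  (wstheta gB j kb), (mu_cycle kaE kbE); split.
- by rewrite !wsgammaE.
- by rewrite wsthetaE kaE !linearZ_LR.
- by rewrite wsthetaE kbE !linearZ_LR.
- by rewrite kin_mkker.
- exact: muP.
Qed.

(** The right side depends on a, r and b only, so this is the independence of
    the weak splittings. *)
Lemma tor_cosetE (gA : wsplit A) (gB : wsplit B)
    (ar : r *: a = 0) (rb : r *: b = 0) :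
  tor_coset gA gB ar rb =
  [set h | exists2 h0, tor_class a r b h0 & cross_sub a b (h - h0)].
Proof.
apply/seteqP; split=> h /=; first by exists (mu gA gB i j (etor ar rb)) => //;
  exact: mu_tor_class.
move=> [h0 h0P hh0]; have [_ subD _] := smem_closed (cross_sub a b).
have := tor_class_unique h0P (mu_tor_class gA gB ar rb).
by move=> /(subD _ _ hh0); rewrite addrA subrK.
Qed.

End Coset.

Section Naturality.
Variables (A B C D : complex R) (e : cmap A C) (f : cmap B D).

Lemma hmap_cross (i j n : int) (a : homology A i) (b : homology B j) :
  hmap (tens_cmap e f) n (cross n a b) = cross n (hmap e i a) (hmap f j b).
Proof.
have [x <-] := hclass_surj a; have [y <-] := hclass_surj b.
rewrite cross_class !hmapE cross_class; congr (hclass _ _ _); apply: kin_inj.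
by rewrite kin_zmap !kin_mkker tens_cmapE !kin_zmap.
Qed.

Lemma hmap_tor_class (i j : int) (a : homology A i) (r : R) (b : homology B j)
    (h : homology (tens_complex A B) (i + j + 1)) :
  tor_class a r b h ->
  tor_class (hmap e i a) r (hmap f j b) (hmap (tens_cmap e f) _ h).
Proof.
move=> [x [y [u [v [z [[<- <-] du dv zE ->]]]]]].
exists (zmap e i x), (zmap f j y), (e _ u), (f _ v), (zmap (tens_cmap e f) _ z).
split.
- by rewrite !hmapE.
- by rewrite -cfunE du linearZ_LR kin_zmap.
- by rewrite -cfunE dv linearZ_LR kin_zmap.
- by rewrite kin_zmap zE linearD linearZ_LR !tens_cmapE !kin_zmap.
- by rewrite hmapE.
Qed.

End Naturality.
End TorClass.

Theorem corollary6p8 (R : idomainType) (R_pid : is_pid R)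
    (A B C D : complex R)
    (torAB : acyclic (tor_complex A B)) (torCD : acyclic (tor_complex C D))
    (e : cmap A C) (f : cmap B D) (i j : int)
    (a : homology A i) (r : R) (b : homology B j)
    (ar : r *: a = 0) (rb : r *: b = 0) :
  [/\ forall (gA gA' : wsplit A) (gB gB' : wsplit B),
        tor_coset gA gB ar rb = tor_coset gA' gB' ar rb,
      forall (gC gC' : wsplit C) (gD gD' : wsplit D),
        tor_coset gC gD (hmap_scale0 e ar) (hmap_scale0 f rb) =
        tor_coset gC' gD' (hmap_scale0 e ar) (hmap_scale0 f rb)
    & forall (gA : wsplit A) (gB : wsplit B) (gC : wsplit C) (gD : wsplit D),
        hmap (tens_cmap e f) (i + j + 1) @` tor_coset gA gB ar rb `<=`
        tor_coset gC gD (hmap_scale0 e ar) (hmap_scale0 f rb)].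
Proof.
split=> [gA gA' gB gB'|gC gC' gD gD'|gA gB gC gD].
- by rewrite !tor_cosetE.
- by rewrite !tor_cosetE.
rewrite !tor_cosetE => _ [h [h0 h0P [y [x hE]]] <-].
exists (hmap (tens_cmap e f) (i + j + 1) h0); first exact: hmap_tor_class.
exists (hmap f _ y), (hmap e _ x).
by rewrite -linearB hE linearD !hmap_cross.
Qed.
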